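(* For all $n\geq 1$, the number of desarrangements of length $n$ avoiding both $132$ and $321$ is $d_n(132,321)=n-1$.
   Context: Permutations are in one-line notation. An index $i\in[n-1]$ is a descent of $\pi\in\mathfrak{S}_n$ if $\pi_i>\pi_{i+1}$; $i\in[n]$ is an ascent if it is not a descent (so $n$ is always an ascent). A desarrangement is a permutation whose first ascent is even. $d_n(\Pi)$ is the number of desarrangements in $\mathfrak{S}_n$ avoiding every pattern in $\Pi$ ($\pi$ avoids $\sigma$ if no subsequence of $\pi$ has the same relative order as $\sigma$). *)

(* Defs.v *)
From mathcomp Require Import all_boot all_fingroup.

Set Implicit Arguments.
Unset Strict Implicit.
Unset Printing Implicit Defensive.

(* One-line notation with values in {1, ..., n}.  Positions are 1-based below,
   so the i-th letter of w is nth 0 w i.-1. *)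
Definition oneline n (p : 'S_n) : seq nat := [seq (val (p i)).+1 | i <- enum 'I_n].

Definition letter (w : seq nat) (i : nat) : nat := nth 0 w i.-1.

Definition is_descent (w : seq nat) (i : nat) : bool :=
  (1 <= i < size w) && (letter w i > letter w i.+1).

Definition is_ascent (w : seq nat) (i : nat) : bool :=
  (1 <= i <= size w) && ~~ is_descent w i.

Definition is_first_ascent (w : seq nat) (i : nat) : bool :=
  is_ascent w i && [forall j : 'I_i, ~~ is_ascent w j].

Definition desarrangement n (p : 'S_n) : bool :=
  [exists i : 'I_n.+1, is_first_ascent (oneline p) i && ~~ odd i].

Definition same_order (s t : seq nat) : bool :=
  (size s == size t) &&
  [forall i : 'I_(size s), forall j : 'I_(size s),
     (nth 0 s i < nth 0 s j) == (nth 0 t i < nth 0 t j)].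

(* Subsequences of w are exactly the mask m w with m of length size w;
   see containsP. *)
Definition contains (w sigma : seq nat) : bool :=
  [exists m : (size w).-tuple bool, same_order (mask m w) sigma].

Lemma containsP (w sigma : seq nat) :
  reflect (exists2 s, subseq s w & same_order s sigma) (contains w sigma).
Proof.
apply: (iffP existsP) => [[m sm]|[s /subseqP[m sz_m ->] sm]].
  by exists (mask m w) => //; apply: mask_subseq.
by exists (Tuple (introT eqP sz_m)).
Qed.

Definition avoids n (p : 'S_n) (sigma : seq nat) : bool :=
  ~~ contains (oneline p) sigma.

(* Patterns are given by their one-line notation. *)
Definition d (n : nat) (Pi : seq (seq nat)) : nat :=
  #|[set p : 'S_n | desarrangement p && all (avoids p) Pi]|.

(* Main.v *)
Require Import Defs.
From mathcomp Require Import all_boot all_fingroup zify.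

(** In a desarrangement the first position is a descent.  Avoiding [321] then
    forces the second letter to be [1], since a smaller letter further right
    would complete a [321]; and avoiding [132] forces everything after this [1]
    to increase.  So the permutation is determined by its first letter, which
    can be anything but [1]. *)

Set Implicit Arguments.
Unset Strict Implicit.
Unset Printing Implicit Defensive.

Lemma same_order3 (x y z a b c : nat) :
  same_order [:: x; y; z] [:: a; b; c] =
  [&& (x < y) == (a < b), (y < x) == (b < a), (x < z) == (a < c),
      (z < x) == (c < a), (y < z) == (b < c) & (z < y) == (c < b)].
Proof.
apply/idP/idP => [/andP[_ /forallP H]|/and5P[/eqP h1 /eqP h2 /eqP h3 /eqP h4]].
  have E i j (hi : i < 3) (hj : j < 3) := forallP (H (Ordinal hi)) (Ordinal hj).
  apply/and5P; split; [exact: (E 0 1)|exact: (E 1 0)|exact: (E 0 2)|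
    exact: (E 2 0)|apply/andP; split; [exact: (E 1 2)|exact: (E 2 1)]].
case/andP=> /eqP h5 /eqP h6; apply/andP; split=> //.
by apply/forallP=> -[[|[|[|//]]] hi]; apply/forallP=> -[[|[|[|//]]] hj] /=;
  rewrite ?ltnn ?h1 ?h2 ?h3 ?h4 ?h5 ?h6.
Qed.

Lemma enum_ord_sorted n : sorted (fun i j : 'I_n => i < j) (enum 'I_n).
Proof. by have := iota_ltn_sorted 0 n; rewrite -val_enum_ord sorted_map. Qed.

(** Replaces masks by three explicit positions, so that exhibiting or refuting a pattern of length 3
    becomes arithmetic on [p]. *)
Lemma contains3P n (p : 'S_n) (a b c : nat) :
  reflect (exists i j k : 'I_n, i < j < k /\
             same_order [:: (p i).+1; (p j).+1; (p k).+1] [:: a; b; c])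
          (contains (oneline p) [:: a; b; c]).
Proof.
have tr : transitive (fun i j : 'I_n => i < j) by move=> ???; apply: ltn_trans.
apply: (iffP (containsP _ _)) => [[s /subseqP[m _ ->]]|[i [j [k [ijk so]]]]].
  rewrite -map_mask => so.
  have : sorted (fun i j : 'I_n => i < j) (mask m (enum 'I_n)).
    by apply: (subseq_sorted tr (mask_subseq m _)) (enum_ord_sorted n).
  case: (mask m _) so => [//|i [//|j [//|k [|//]]]] so /and3P[ij jk _].
  by exists i, j, k; rewrite ij jk.
exists [seq (val (p l)).+1 | l <- [:: i; j; k]] => //.
apply: map_subseq; case/andP: ijk => ij jk.
set s := [:: i; j; k].
(* Two strictly increasing lists with the same members are equal; as a filter, [s] is visibly a
   subsequence. *)
have -> : s = [seq l <- enum 'I_n | l \in s].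
  apply: (irr_sorted_eq tr) => [l|||l]; first exact: ltnn.
  - by rewrite /= ij jk.
  - exact: (sorted_filter tr) (enum_ord_sorted n).
  - by rewrite mem_filter mem_enum andbT.
exact: filter_subseq.
Qed.

Lemma letter_oneline n (p : 'S_n) (i : 'I_n) : letter (oneline p) i.+1 = (p i).+1.
Proof. by rewrite /letter /= (nth_map i) ?size_enum_ord ?nth_ord_enum. Qed.

Lemma size_oneline n (p : 'S_n) : size (oneline p) = n.
Proof. by rewrite size_map size_enum_ord. Qed.

(** The first ascent is even and positive, hence at least 2, so position 1 lies before it and is not
    an ascent. *)
Lemma desarrangement_descent1 n (p : 'S_n) :
  0 < n -> desarrangement p -> is_descent (oneline p) 1.
Proof.
move=> n0 /existsP[[[|[|i]] hi]] /andP[/andP[]] //= _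
  /forallP/(_ (Ordinal (isT : 1 < i.+2))).
by rewrite /is_ascent size_oneline /= n0 /= => /negPn.
Qed.

(** [lift_perm ord0 a 1] puts [a] first and then the other values in increasing order. Both tails
    are increasing lists of the values other than [p ord0], so they agree. *)
Lemma increasing_tail_lift_perm n (p : 'S_n.+1) :
  (forall j k : 'I_n.+1, 0 < j < k -> p j < p k) ->
  p = lift_perm ord0 (p ord0) 1.
Proof.
move=> p_incr.
pose lt (i j : 'I_n.+1) := i < j.
have tr : transitive lt by move=> ???; apply: ltn_trans.
have eq_tail : [seq p (lift ord0 k) | k <- enum 'I_n] =
               [seq lift (p ord0) k | k <- enum 'I_n].
  apply: (irr_sorted_eq tr) => [l|||l]; first exact: ltnn.
  - rewrite sorted_map; apply: sub_sorted (enum_ord_sorted n) => i j ij.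
    exact: p_incr.
  - rewrite sorted_map; apply: sub_sorted (enum_ord_sorted n) => i j ij.
    by rewrite /lt /= /bump; lia.
  apply/mapP/mapP => [[k _ ->]|[k _ ->]].
    have: p ord0 != p (lift ord0 k) by rewrite (inj_eq perm_inj) neq_lift.
    by case/unlift_some=> m -> _; exists m; rewrite ?mem_enum.
  have: ord0 != (p^-1)%g (lift (p ord0) k).
    by apply/eqP=> /(congr1 p); rewrite permKV; apply/eqP; apply: neq_lift.
  by case/unlift_some=> m E _; exists m; rewrite ?mem_enum // -E permKV.
apply/permP=> i; case: (unliftP ord0 i) => [k ->|->]; last by rewrite lift_perm_id.
rewrite lift_perm_lift perm1.
by move/eq_in_map: eq_tail; apply; rewrite mem_enum.
Qed.

Lemma desarrangement_av132_av321 n (p : 'S_n.+1) :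
  desarrangement p && all (avoids p) [:: [:: 1; 3; 2]; [:: 3; 2; 1]] =
  (p ord0 != ord0) && (p == lift_perm ord0 (p ord0) 1).
Proof.
apply/and4P/andP => [[/desarrangement_descent1 -/(_ isT) des av132 av321 _]|].
  case: n p des av132 av321 => [|n] p; first by rewrite /is_descent size_oneline.
  pose i1 : 'I_n.+2 := Ordinal (isT : 1 < n.+2).
  case/andP=> _; rewrite (letter_oneline p ord0) (letter_oneline p i1) ltnS.
  move=> p10 /contains3P av132 /contains3P av321.
  (* Otherwise positions 0, 1, [k] carry a 321. *)
  have p_gt1 (k : 'I_n.+2) : 1 < k -> p i1 < p k.
    move=> k1; rewrite ltnNge; apply/negP=> le_k1.
    have: p k != p i1 by rewrite (inj_eq perm_inj) -val_eqE /=; lia.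
    rewrite -val_eqE /= => ne_k1; apply: av321; exists ord0, i1, k.
    by rewrite same_order3 /=; split; lia.
  split; first by rewrite -val_eqE /=; lia.
  apply/eqP; apply: increasing_tail_lift_perm => j k /andP[j0 jk].
  case: (ltnP 1 j) => [j1|j1]; last first.
    have -> : j = i1 by apply: val_inj => /=; lia.
    by apply: p_gt1; lia.
  (* A descent from [j] to [k] beyond position 1 would form a 132 with the minimal letter at
     [i1]. *)
  rewrite ltnNge; apply/negP=> le_kj.
  have: p k != p j by rewrite (inj_eq perm_inj) -val_eqE /=; lia.
  have := p_gt1 _ j1; have := p_gt1 k (ltn_trans j1 jk).
  rewrite -val_eqE /= => pk pj ne_kj; apply: av132; exists i1, j, k.
  by rewrite same_order3 /=; split; lia.
move=> [p0 /eqP Ep].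
have p_incr (j k : 'I_n.+1) : 0 < j < k -> p j < p k.
  rewrite Ep; case: (unliftP ord0 j) => [j' ->|->//].
  case: (unliftP ord0 k) => [k' ->|->]; last by rewrite ltn0 andbF.
  by rewrite !lift_perm_lift !perm1 /= /bump; lia.
split=> //.
- case: n p p0 Ep p_incr => [|n] p p0 Ep p_incr; first by rewrite ord1 in p0.
  pose i1 : 'I_n.+2 := Ordinal (isT : 1 < n.+2).
  (* The tail starts with the least value other than [p ord0], which is [ord0] because [p ord0] is
     not. *)
  have p1 : p i1 = ord0.
    have -> : i1 = lift ord0 ord0 by apply: val_inj.
    apply: val_inj; rewrite Ep lift_perm_lift perm1 /= /bump.
    by move: p0; rewrite -val_eqE /=; lia.
  apply/existsP; exists (Ordinal (isT : 2 < n.+3)); rewrite andbT.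
  apply/andP; split.
    rewrite /is_ascent /is_descent size_oneline /=.
    (* If 2 is the last position, it is an ascent by convention. *)
    case: ltnP => //= n2.
    rewrite (letter_oneline p i1) (letter_oneline p (Ordinal n2)) p1 /=; lia.
  apply/forallP=> -[[|[|//]] hj] //=.
  rewrite /is_ascent /is_descent size_oneline /= negbK.
  rewrite (letter_oneline p ord0) (letter_oneline p i1) p1 /=.
  by move: p0; rewrite -val_eqE /=; lia.
(* Both patterns end with a descent from [j] to [k], and [i < j] places these two positions in the
   increasing tail. *)
- apply/contains3P=> -[i [j [k [/andP[ij jk]]]]]; rewrite same_order3.
  by have := p_incr j k; lia.
- apply/contains3P=> -[i [j [k [/andP[ij jk]]]]]; rewrite same_order3.
  by have := p_incr j k; lia.
Qed.

Theorem theorem3p13 (n : nat) (hn : 1 <= n) :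
  d n [:: [:: 1; 3; 2]; [:: 3; 2; 1]] = n - 1.
Proof.
case: n hn => // n _; rewrite /d subn1 /=.
pose f (a : 'I_n.+1) : 'S_n.+1 := lift_perm ord0 a 1.
have f_inj : injective f.
  by move=> a b /permP/(_ ord0); rewrite !lift_perm_id.
(* The first letter parametrizes the set: every value except [ord0] occurs, each exactly once. *)
have -> : [set p : 'S_n.+1 | desarrangement p &&
            all (avoids p) [:: [:: 1; 3; 2]; [:: 3; 2; 1]]] = f @: [set~ ord0].
  apply/setP=> p; rewrite inE desarrangement_av132_av321.
  apply/andP/imsetP => [[p0 /eqP ->]|[a]].
    by exists (p ord0); rewrite // in_setC1.
  by rewrite in_setC1 => a0 ->; rewrite /f lift_perm_id.
by rewrite card_imset // cardsC1 card_ord.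
Qed.
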